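(* Maximum-cardinality bipartite matching is NC-reducible to the popular matching problem with preference lists that may contain ties: given a black box solving the popular matching problem (outputting a popular matching or reporting none exists) with ties, a maximum-cardinality matching of any bipartite graph can be computed in NC using this black box.
   Context: An instance of the popular matching problem with ties consists of applicants $\mathcal{A}$, posts $\mathcal{P}$, and a bipartite graph $G=(\mathcal{A}\cup\mathcal{P},E)$ with a partition $E=E_1\dot\cup\cdots\dot\cup E_r$; an edge in $E_i$ has rank $i$, and applicant $a$ prefers $p$ to $p'$ if $(a,p)\in E_i$, $(a,p')\in E_j$ with $i<j$, and is indifferent if $i=j$. An applicant $a$ prefers matching $M'$ to $M$ if $a$ is matched in $M'$ and unmatched in $M$, or matched in both and prefers $M'(a)$ to $M(a)$. With $P(M,M')$ the set of applicants preferring $M$ to $M'$, $M'$ is more popular than $M$ if $|P(M',M)|>|P(M,M')|$, and $M$ is popular if no matching is more popular than $M$. The popular matching problem asks to find a popular matching or determine none exists. *)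

(* Defs.v *)
From mathcomp Require Import all_boot.

Set Implicit Arguments.
Unset Strict Implicit.
Unset Printing Implicit Defensive.

Record bigraph := BiGraph {
  applicants : nat;
  posts : nat;
  edges : {set 'I_applicants * 'I_posts} }.

Definition is_matching (G : bigraph) (M : {set 'I_(applicants G) * 'I_(posts G)})
  : bool :=
  (M \subset edges G) &&
  [forall e in M, forall f in M, ((e.1 == f.1) || (e.2 == f.2)) ==> (e == f)].

Definition is_max_matching (G : bigraph)
    (M : {set 'I_(applicants G) * 'I_(posts G)}) : Prop :=
  is_matching M /\
  forall M' : {set 'I_(applicants G) * 'I_(posts G)},
    is_matching M' -> #|M'| <= #|M|.

(* Rank classes are indexed from 0: [rank_class i] is E_(i+1). A rank class may
   be empty. *)
Record ties_instance := TiesInstance {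
  graph :> bigraph;
  num_ranks : nat;
  rank_class :
    {ffun 'I_num_ranks -> {set 'I_(applicants graph) * 'I_(posts graph)}};
  rank_class_cover : \bigcup_i rank_class i == edges graph;
  rank_class_disjoint :
    [forall i, forall j, (i != j) ==> [disjoint rank_class i & rank_class j]] }.

Section Popularity.
Variable I : ties_instance.
Implicit Types (a : 'I_(applicants I)) (p : 'I_(posts I)).
Implicit Types M : {set 'I_(applicants I) * 'I_(posts I)}.

Definition prefers_post a p p' : bool :=
  [exists i, exists j,
    [&& (a, p) \in rank_class I i, (a, p') \in rank_class I j & i < j]].

Definition matched M a : bool := [exists p, (a, p) \in M].

Definition prefers M' M a : bool :=
  (matched M' a && ~~ matched M a) ||
  [exists p', exists p,
    [&& (a, p') \in M', (a, p) \in M & prefers_post a p' p]].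

Definition more_popular M' M : bool :=
  #|[set a | prefers M' M a]| > #|[set a | prefers M M' a]|.

Definition popular M : Prop :=
  is_matching M /\ forall M', is_matching M' -> ~~ more_popular M' M.

End Popularity.

Record search_problem := SearchProblem {
  input : Type;
  answer : input -> Type;
  correct : forall x, answer x -> Prop;
  encode_input : input -> seq nat;
  encode_answer : forall x, answer x -> seq nat }.

Definition solves (O : seq nat -> seq nat) (Q : search_problem) : Prop :=
  forall x : input Q, exists y : answer x,
    correct y /\ O (encode_input x) = encode_answer y.

(* Sizes are written in unary, so that the length of an encoded graph is at
   least its number of vertices, and all its words are bits. *)
Definition unary (k : nat) : seq nat := rcons (nseq k 1) 0.

Definition encode_graph (G : bigraph) : seq nat :=
  unary (applicants G) ++ unary (posts G) ++
  [seq nat_of_bool ((a, p) \in edges G)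
     | a <- enum 'I_(applicants G), p <- enum 'I_(posts G)].

(* Word of the rank matrix: the rank (from 1) of an edge, 0 for a non-edge. *)
Definition rank_word (I : ties_instance)
    (a : 'I_(applicants I)) (p : 'I_(posts I)) : nat :=
  if [pick i | (a, p) \in rank_class I i] is Some i then i.+1 else 0.

Definition encode_instance (I : ties_instance) : seq nat :=
  unary (num_ranks I) ++ unary (applicants I) ++ unary (posts I) ++
  [seq rank_word a p
     | a <- enum 'I_(applicants I), p <- enum 'I_(posts I)].

(* One word per applicant: j + 1 if it is matched to post j, 0 if unmatched. *)
Definition encode_matching (n m : nat) (M : {set 'I_n * 'I_m}) : seq nat :=
  [seq (if [pick p | (a, p) \in M] is Some p then (p : nat).+1 else 0)
     | a <- enum 'I_n].

Definition max_bipartite_matching : search_problem :=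
  @SearchProblem bigraph
    (fun G => {set 'I_(applicants G) * 'I_(posts G)})
    is_max_matching
    encode_graph
    (fun G M => encode_matching M).

Definition popular_matching_with_ties : search_problem :=
  @SearchProblem ties_instance
    (fun I => option {set 'I_(applicants I) * 'I_(posts I)})
    (fun I ans => if ans is Some M then popular M else forall M, ~ @popular I M)
    encode_instance
    (fun I ans => if ans is Some M then 1 :: encode_matching M else [:: 0]).

(* Registers and labels are named by constants; [d] is a destination register,
   [x], [y] are source registers. [IRead] and [IWrite] address the shared memory
   indirectly through [x]. [IQuery x y] submits the block at address [x] to the
   oracle, whose reply becomes the block at address [y]. *)
Inductive instr :=
  | IConst (d c : nat)
  | IAdd (d x y : nat)
  | ISub (d x y : nat)
  | IHalf (d x : nat)
  | IRead (d x : nat)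
  | IWrite (x y : nat)
  | IJumpZero (x l : nat)
  | IQuery (x y : nat).

Definition program := seq instr.

Definition memory := nat -> nat.

(* A finite sequence of words is stored as a block: its length, followed by its
   words. *)
Definition read_block (m : memory) (a : nat) : seq nat :=
  [seq m i | i <- iota a.+1 (m a)].

Definition block_writes (a : nat) (s : seq nat) : seq (nat * nat) :=
  zip (iota a (size s).+1) (size s :: s).

(* Earlier writes in the list take precedence. *)
Definition write (ws : seq (nat * nat)) (m : memory) : memory :=
  foldr (fun w m' a => if a == w.1 then w.2 else m' a) m ws.

Record processor := Processor { pc : nat; reg : nat -> nat }.

Definition set_reg (s : processor) (d v : nat) : processor :=
  Processor (pc s).+1 (fun r => if r == d then v else reg s r).

Definition advance (s : processor) : processor := Processor (pc s).+1 (reg s).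

(* A processor whose program counter is outside the program has halted. *)
Definition proc_step (O : seq nat -> seq nat) (prog : program) (m : memory)
    (s : processor) : processor * seq (nat * nat) :=
  match onth prog (pc s) with
  | None => (s, [::])
  | Some (IConst d c) => (set_reg s d c, [::])
  | Some (IAdd d x y) => (set_reg s d (reg s x + reg s y), [::])
  | Some (ISub d x y) => (set_reg s d (reg s x - reg s y), [::])
  | Some (IHalf d x) => (set_reg s d (reg s x)./2, [::])
  | Some (IRead d x) => (set_reg s d (m (reg s x)), [::])
  | Some (IWrite x y) => (advance s, [:: (reg s x, reg s y)])
  | Some (IJumpZero x l) =>
      (if reg s x == 0 then Processor l (reg s) else advance s, [::])
  | Some (IQuery x y) =>
      (advance s, block_writes (reg s y) (O (read_block m (reg s x))))
  end.

Record config := Config { mem : memory; proc : nat -> processor }.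

(* Processors [0 .. np - 1] run in lockstep: all reads precede all writes, and
   on a write conflict the processor of least index wins (priority CRCW). *)
Definition step (O : seq nat -> seq nat) (prog : program) (np : nat)
    (C : config) : config :=
  Config
    (write (flatten [seq (proc_step O prog (mem C) (proc C i)).2
                       | i <- iota 0 np]) (mem C))
    (fun i => (proc_step O prog (mem C) (proc C i)).1).

(* The input is the block at address 0; register 0 holds the processor index. *)
Definition init (w : seq nat) : config :=
  Config (write (block_writes 0 w) (fun _ => 0))
         (fun i => Processor 0 (fun r => if r == 0 then i else 0)).

Definition run (O : seq nat -> seq nat) (prog : program) (np : nat)
    (w : seq nat) (t : nat) : config :=
  iter t (step O prog np) (init w).

Definition halted (prog : program) (np : nat) (C : config) : Prop :=
  forall i, i < np -> size prog <= pc (proc C i).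

Definition words_le (np W : nat) (C : config) : Prop :=
  (forall a, mem C a <= W) /\
  (forall i r, i < np -> reg (proc C i) r <= W).

Definition poly_bound (c k N : nat) : nat := c * N ^ k + c.

Definition polylog_bound (c k N : nat) : nat := c * trunc_log 2 N ^ k + c.

(* One program serves all inputs and all oracles, hence the reduction is
   uniform. On inputs of length N it uses polynomially many processors and
   polylogarithmic time; all words are polynomially bounded (O(log N) bits), so
   each of the unit-cost oracle queries has polynomial length. *)
Definition NC_reducible (P Q : search_problem) : Prop :=
  exists (prog : program) (c k : nat),
    forall O : seq nat -> seq nat, solves O Q ->
    forall x : input P,
      let w := encode_input x in
      let N := size w in
      let np := poly_bound c k N in
      exists t : nat,
        [/\ t <= polylog_bound c k N,
            halted prog np (run O prog np w t),
            forall t', t' <= t -> words_le np (poly_bound c k N)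
                                    (run O prog np w t') &
            exists y : answer x,
              correct y /\
              read_block (mem (run O prog np w t)) 0 = encode_answer y].

(* Main.v *)
(** If every edge has rank 1, an applicant prefers one matching to another exactly
    when it is matched in the former only, so the popular matchings are the
    maximum-cardinality ones.  The encoding of this instance is [1 :: 0 :: w],
    where [w] encodes the graph.  A straight-line program therefore suffices:
    shift the input by two cells, query the oracle, and drop the leading flag of
    its reply, which is never "none" since a maximum matching exists. *)
Require Import Defs.
From mathcomp Require Import all_boot zify.
From Stdlib Require Import FunctionalExtensionality.

Set Implicit Arguments.
Unset Strict Implicit.
Unset Printing Implicit Defensive.

(** * Popularity with a single rank class *)

Section SingleRank.
Variable G : bigraph.
Implicit Types M : {set 'I_(applicants G) * 'I_(posts G)}.

Let single_class :
  {ffun 'I_1 -> {set 'I_(applicants G) * 'I_(posts G)}} := [ffun=> edges G].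

Fact single_class_cover : \bigcup_i single_class i == edges G.
Proof. by rewrite big_ord1 ffunE. Qed.

Fact single_class_disjoint :
  [forall i, forall j,
     (i != j) ==> [disjoint single_class i & single_class j]].
Proof. by apply/forallP=> i; apply/forallP=> j; rewrite !ord1 eqxx. Qed.

Definition single_rank : ties_instance :=
  TiesInstance single_class_cover single_class_disjoint.

Lemma prefers_single_rank M' M a :
  @prefers single_rank M' M a =
  @matched single_rank M' a && ~~ @matched single_rank M a.
Proof.
rewrite /prefers; case: existsP => [[p' /existsP[p /and3P[_ _]]]|_].
  by case/existsP=> i /existsP[j /and3P[_ _]]; rewrite !ord1.
by rewrite orbF.
Qed.

(** Projection to the applicant is injective on a matching. *)
Lemma card_matched M :
  is_matching M -> #|[set a | @matched single_rank M a]| = #|M|.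
Proof.
case/andP=> _ /forall_inP Mmatch.
have -> : [set a | @matched single_rank M a] = [set e.1 | e in M].
  apply/setP=> a; rewrite inE; apply/existsP/imsetP => [[p Map]|[[b p] Mbp ->]].
    by exists (a, p).
  by exists p.
apply: card_in_imset => e f Me Mf eq1.
by move/forall_inP: (Mmatch e Me) => /(_ f Mf); rewrite eq1 eqxx /= => /eqP.
Qed.

(** The sets of preferring applicants are the two differences of the matched sets [A] and [B];
    adding the common part [A :&: B] to both preserves the comparison. *)
Lemma more_popular_single_rank M' M : is_matching M' -> is_matching M ->
  @more_popular single_rank M' M = (#|M| < #|M'|).
Proof.
move=> M'match Mmatch; rewrite /more_popular.
have prefE X Y : [set a | @prefers single_rank X Y a] =
    [set a | @matched single_rank X a] :\: [set a | @matched single_rank Y a].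
  by apply/setP=> a; rewrite !inE prefers_single_rank andbC.
rewrite !prefE -(card_matched M'match) -(card_matched Mmatch).
set A := [set a | _ M a]; set B := [set a | _ M' a].
by rewrite -(cardsID B A) -(cardsID A B) [B :&: A]setIC ltn_add2l.
Qed.

Lemma popular_single_rank M : @popular single_rank M <-> is_max_matching M.
Proof.
split=> -[Mmatch Mbest]; split=> // M' M'match.
  by rewrite leqNgt -more_popular_single_rank // Mbest.
by rewrite more_popular_single_rank // -leqNgt Mbest.
Qed.

(** [unary 1] supplies the two leading words, and ranks counted from 1 turn the rank matrix into the
    adjacency bits. *)
Lemma encode_single_rank : encode_instance single_rank = 1 :: 0 :: encode_graph G.
Proof.
rewrite /encode_instance /encode_graph /=; congr [:: _, _ & _ ++ (_ ++ _)].
apply: eq_allpairs => a p; rewrite /rank_word.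
case: pickP => [i|/(_ ord0)]; rewrite ffunE => ->; last by [].
by rewrite ord1.
Qed.

End SingleRank.

Lemma max_matching_exists (G : bigraph) :
  exists M : {set 'I_(applicants G) * 'I_(posts G)}, is_max_matching M.
Proof.
have match0 : @is_matching G set0.
  by rewrite /is_matching sub0set; apply/forall_inP=> e; rewrite inE.
by case: (arg_maxnP (fun M => #|M : {set _}|) match0) => M; exists M.
Qed.

(** * Lengths and word bounds of the encodings *)

Lemma encode_graph_size (G : bigraph) :
  size (encode_graph G) =
  (applicants G).+1 + (posts G).+1 + applicants G * posts G.
Proof.
by rewrite !size_cat !size_rcons !size_nseq size_allpairs !size_enum_ord addnA.
Qed.

Lemma encode_graph_bits (G : bigraph) : all (geq 1) (encode_graph G).
Proof.
rewrite !all_cat !all_rcons !all_nseq !orbT /=.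
by apply/allP=> _ /allpairsP[[a p] [_ _ ->]] /=; case: (_ \in _).
Qed.

Lemma encode_matching_le n m (M : {set 'I_n * 'I_m}) :
  all (geq m) (encode_matching M).
Proof. by apply/allP=> _ /mapP[a _ ->]; case: pickP => [p _|]; rewrite /= ?ltn_ord. Qed.

(** * Effect of simultaneous writes on memory *)

Lemma write_cat s1 s2 m : write (s1 ++ s2) m = write s1 (write s2 m).
Proof. exact: foldr_cat. Qed.

(** A cell addressed by [s] gets the same value over any base memory; at any other cell [write s m]
    agrees with [m], so both alternatives of the hypothesis coincide. *)
Lemma write_absorb s m m' a :
  m' a = m a \/ m' a = write s m a -> write s m' a = write s m a.
Proof. by elim: s => /= [|w s IHs]; [case | case: eqP]. Qed.

(** Identical writes by several processors collapse to one by [write_absorb]; with no processor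
    nothing would be written. *)
Lemma write_const (T : Type) (l : seq T) s m : 0 < size l ->
  write (flatten [seq s | _ <- l]) m = write s m.
Proof.
case: l => // x l _; apply: functional_extensionality => a.
elim: l x => [|y l IHl] x; first by rewrite /= cats0.
rewrite map_cons /= write_cat; apply: write_absorb; right; exact: (IHl y).
Qed.

Lemma write_own n v m :
  write (flatten [seq [:: (i, v i)] | i <- iota 0 n]) m =
  fun a => if a < n then v a else m a.
Proof.
rewrite flatten_map1; apply: functional_extensionality => a.
suff write_iota k : k <= a ->
    write [seq (i, v i) | i <- iota k n] m a = if a < k + n then v a else m a.
  exact: write_iota.
elim: n k => [|n IHn] k le_ka /=; first by rewrite addn0 ltnNge le_ka.
case: eqP => [->|ne_ak]; first by rewrite -addSnnS leq_addr.
by rewrite IHn ?addSnnS //; lia.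
Qed.

Lemma write_block0 s m :
  write (block_writes 0 s) m =
  fun a => if a <= size s then nth 0 (size s :: s) a else m a.
Proof.
apply: functional_extensionality => a; rewrite /block_writes.
suff write_zip b t : b <= a ->
    write (zip (iota b (size t)) t) m a =
    if a < b + size t then nth 0 t (a - b) else m a.
  by have := write_zip 0 (size s :: s) isT; rewrite subn0.
elim: t b => [|x t IHt] b le_ba /=; first by rewrite addn0 ltnNge le_ba.
case: eqP => [->|ne_ab]; first by rewrite subnn -addSnnS leq_addr.
rewrite IHt -?addSnnS; last by lia.
by have -> : a - b = (a - b.+1).+1 by lia.
Qed.

Lemma read_block0 m s : m 0 = size s ->
  (forall i, i < size s -> m i.+1 = nth 0 s i) -> read_block m 0 = s.
Proof.
move=> m0 mS; rewrite /read_block m0.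
apply: (@eq_from_nth _ 0) => [|i]; rewrite size_map size_iota // => lt_is.
by rewrite (nth_map 0) ?size_iota // nth_iota // mS.
Qed.

(* Register 5 is never written, so it holds 0.  Every processor issues the same
   query.  Shifts are pulled (processor [i] fetches the new content of cell [i])
   so that no register exceeds the number of processors, which is also the bound
   on words. *)
Definition reduction : program :=
  [:: IConst 1 1; IConst 2 2;
      ISub 3 0 2; IRead 3 3; IWrite 0 3;
      IRead 4 5; IAdd 4 4 2; IWrite 5 4; IWrite 1 1; IWrite 2 5;
      IQuery 5 5;
      IRead 4 5; ISub 4 4 1; IAdd 3 0 1; IRead 3 3; IWrite 0 3; IWrite 5 4].

(** * Lockstep execution without jumps *)

Section StraightLine.
Variables (O : seq nat -> seq nat) (prog : program) (np W : nat) (w : seq nat).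

(** Without jumps every program counter equals the time [t]. Carrying the word bound for all earlier
    times leaves only the newest configuration to check at each step. *)
Definition reaches (t : nat) (m : memory) (R : nat -> nat -> nat) : Prop :=
  run O prog np w t = Config m (fun i => Processor t (R i)) /\
  forall t', t' <= t -> words_le np W (run O prog np w t').

Lemma reaches_step t m R m' R' ws :
  reaches t m R ->
  (forall i,
     proc_step O prog m (Processor t (R i)) = (Processor t.+1 (R' i), ws i)) ->
  write (flatten [seq ws i | i <- iota 0 np]) m = m' ->
  (forall a, m' a <= W) -> (forall i r, i < np -> R' i r <= W) ->
  reaches t.+1 m' R'.
Proof.
move=> [runt bound] stepE <- m'W R'W.
have runS : run O prog np w t.+1 =
    Config (write (flatten [seq ws i | i <- iota 0 np]) m)
           (fun i => Processor t.+1 (R' i)).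
  rewrite /run iterS -/(run O prog np w t) runt /step /=; congr Config.
    by congr (write (flatten _) m); apply: eq_map => i; rewrite stepE.
  by apply: functional_extensionality => i; rewrite stepE.
split=> // t'; rewrite leq_eqVlt => /predU1P[->|]; last exact: bound.
by rewrite runS; split.
Qed.

Lemma reaches_set t m R d v :
  reaches t m R ->
  (forall i, proc_step O prog m (Processor t (R i)) =
             (set_reg (Processor t (R i)) d (v i), [::])) ->
  (forall i, i < np -> v i <= W) ->
  reaches t.+1 m (fun i r => if r == d then v i else R i r).
Proof.
move=> reach stepE vW; have [runt /(_ t (leqnn t))] := reach.
rewrite runt => -[/= mW RW]; apply: (reaches_step reach stepE) => //.
  by elim: (iota 0 np).
by move=> i r lt_i; case: eqP => // _; [apply: vW | apply: RW].
Qed.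

Lemma reaches_write t m m' R ws :
  reaches t m R ->
  (forall i, proc_step O prog m (Processor t (R i)) =
             (Processor t.+1 (R i), ws i)) ->
  write (flatten [seq ws i | i <- iota 0 np]) m = m' ->
  (forall a, m' a <= W) -> reaches t.+1 m' R.
Proof.
move=> reach stepE m'E m'W; apply: (reaches_step reach stepE) => //.
by have [runt /(_ t (leqnn t))] := reach; rewrite runt => -[].
Qed.

End StraightLine.

(** The query block occupies [size w + 3] cells, each filled by its own processor; [size s < np]
    makes the length word [(size s).+1] of the reply fit and lets the second shift reach all of
    [s]. *)
Lemma reduction_run (O : seq nat -> seq nat) (np : nat) (w s : seq nat) :
  O [:: 1, 0 & w] = 1 :: s ->
  size w + 3 <= np -> size s < np -> all (geq np) w -> all (geq np) s ->
  exists m R, reaches O reduction np np w 17 m R /\ read_block m 0 = s.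
Proof.
move=> Ow np_w np_s /all_nthP w_le /all_nthP s_le.
have wW i : nth 0 w i <= np.
  by case: (ltnP i (size w)) => [/(w_le 0)//|/(nth_default _)->].
have sW i : nth 0 s i <= np.
  by case: (ltnP i (size s)) => [/(s_le 0)//|/(nth_default _)->].
have np_gt0 : 0 < size (iota 0 np) by rewrite size_iota; lia.
pose m0 := nth 0 (size w :: w).
have m0W a : m0 a <= np by rewrite /m0; case: a => [|a] /=; [lia | exact: wW].
have m0_default a : size w < a -> m0 a = 0 by move=> lt_a; rewrite /m0 nth_default.
have r0 : reaches O reduction np np w 0 m0 (fun i r => if r == 0 then i else 0).
  have run0 : run O reduction np w 0 =
      Config m0 (fun i => Processor 0 (fun r => if r == 0 then i else 0)).
    rewrite /run /= /init write_block0; congr Config.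
    apply: functional_extensionality => a.
    by case: leqP => // /m0_default.
  split=> // t'; rewrite leqn0 => /eqP->; rewrite run0; split=> //= i r lt_i.
  by case: eqP => // _; exact: ltnW.
have r1 := reaches_set r0 (d := 1) (v := fun=> 1) (fun=> erefl).
have {r0}r1 := r1 ltac:(move=> * /=; lia).
have r2 := reaches_set r1 (d := 2) (v := fun=> 2) (fun=> erefl).
have {r1}r2 := r2 ltac:(move=> * /=; lia).
have r3 := reaches_set r2 (d := 3) (v := fun i => i - 2) (fun=> erefl).
have {r2}r3 := r3 ltac:(move=> * /=; lia).
have r4 := reaches_set r3 (d := 3) (v := fun i => m0 (i - 2)) (fun=> erefl).
have {r3}r4 := r4 ltac:(move=> * /=; exact: m0W).
(* Truncated subtraction sends 0, 1 and 2 to cell 0, so after the shift cell 0 still holds [size w].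
   Cells 0 to 2 are then overwritten by the new length and the prefix 1, 0. *)
pose m1 a := if a < np then m0 (a - 2) else m0 a.
have m1W a : m1 a <= np by rewrite /m1; case: ifP.
have {r4}r5 : reaches O reduction np np w 5 m1 _ :=
  reaches_write r4 (ws := fun i => [:: (i, m0 (i - 2))])
  (fun=> erefl) (write_own _ _ _) m1W.
have m10 : m1 0 = size w by rewrite /m1; case: ifP.
have m12W : m1 0 + 2 <= np by rewrite m10; lia.
have r6 := reaches_set r5 (d := 4) (v := fun=> m1 0) (fun=> erefl).
have {r5}r6 := r6 ltac:(move=> * /=; exact: m1W).
have r7 := reaches_set r6 (d := 4) (v := fun=> m1 0 + 2) (fun=> erefl).
have {r6}r7 := r7 ltac:(move=> *; exact: m12W).
pose put x v (m : memory) := write [:: (x, v)] m.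
have putW x v m : v <= np -> (forall a, m a <= np) -> forall a, put x v m a <= np.
  by move=> vW mW a; rewrite /put /=; case: eqP.
have r8 := reaches_write r7 (ws := fun=> [:: (0, m1 0 + 2)]) (fun=> erefl)
  (write_const _ _ np_gt0).
have m2W := putW 0 (m1 0 + 2) m1 m12W m1W.
have {r7}r8 := r8 m2W.
have r9 := reaches_write r8 (ws := fun=> [:: (1, 1)]) (fun=> erefl)
  (write_const _ _ np_gt0).
have m3W := putW 1 1 _ ltac:(lia) m2W.
have {r8}r9 := r9 m3W.
have r10 := reaches_write r9 (ws := fun=> [:: (2, 0)]) (fun=> erefl)
  (write_const _ _ np_gt0).
have {m3W}m4W := putW 2 0 _ ltac:(lia) m3W.
have {r9}r10 := r10 m4W.
set m4 := write [:: (2, 0)] _ in r10.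
have queryE : read_block m4 0 = [:: 1, 0 & w].
  apply: read_block0 => [|[|[|i]]] //=; first by rewrite /m4 /= m10 addn2.
  rewrite !ltnS => lt_i; rewrite /m4 /= /m1 ifT; last by lia.
  by rewrite subn2.
(* The reply block is its length, the flag 1, then [s]; later cells keep what [m4] held. *)
pose m5 a := if a <= (size s).+1 then nth 0 [:: (size s).+1, 1 & s] a else m4 a.
have m5W a : m5 a <= np.
  rewrite /m5; case: ifP => _; last exact: m4W.
  by case: a => [|[|a]] //=; lia.
have r11 := reaches_write r10
  (ws := fun=> block_writes 0 (O (read_block m4 0))) (fun=> erefl)
  (write_const _ _ np_gt0).
rewrite queryE Ow write_block0 in r11.
have {r10}r11 : reaches O reduction np np w 11 m5 _ := r11 m5W.
(* Register 4 saves the length, since the left shift will put the flag in cell 0. *)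
have r12 := reaches_set r11 (d := 4) (v := fun=> m5 0) (fun=> erefl).
have m51W : m5 0 - 1 <= np by rewrite /m5 /=; lia.
have {r11}r12 := r12 ltac:(move=> * /=; exact: m5W).
have r13 := reaches_set r12 (d := 4) (v := fun=> m5 0 - 1) (fun=> erefl).
have {r12}r13 := r13 ltac:(move=> *; exact: m51W).
have r14 := reaches_set r13 (d := 3) (v := fun i => i + 1) (fun=> erefl).
have {r13}r14 := r14 ltac:(move=> * /=; lia).
have r15 := reaches_set r14 (d := 3) (v := fun i => m5 (i + 1)) (fun=> erefl).
have {r14}r15 := r15 ltac:(move=> * /=; exact: m5W).
pose m6 a := if a < np then m5 (a + 1) else m5 a.
have m6W a : m6 a <= np by rewrite /m6; case: ifP.
have {r15}r16 : reaches O reduction np np w 16 m6 _ :=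
  reaches_write r15 (ws := fun i => [:: (i, m5 (i + 1))])
  (fun=> erefl) (write_own _ _ _) m6W.
have r17 := reaches_write r16 (ws := fun=> [:: (0, m5 0 - 1)]) (fun=> erefl)
  (write_const _ _ np_gt0).
have {r16}r17 := r17 (putW 0 (m5 0 - 1) m6 m51W m6W).
exists (put 0 (m5 0 - 1) m6); eexists; split; first exact: r17.
apply: read_block0 => [|i lt_i]; rewrite /put /=.
  by rewrite /m5 /= subn1.
by rewrite /m6 ifT ?addn1 ?/m5 /= ?ifT //; lia.
Qed.

Theorem theorem8 : NC_reducible max_bipartite_matching popular_matching_with_ties.
Proof.
(* 17 is the number of instructions, hence the running time, covered by the additive constant of
   [polylog_bound]. *)
exists reduction, 17, 1 => O solvesO G w N np.
have N_size : N = _ := encode_graph_size G.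
have np_size : np = 17 * N + 17 by rewrite /np /poly_bound expn1.
have [[M|] [Mbest OM]] := solvesO (single_rank G); last first.
  have [M /popular_single_rank Mpop] := max_matching_exists G.
  by case: (Mbest M Mpop).
have size_M : size (encode_matching (M : {set 'I_(applicants G) * 'I_(posts G)}))
    = applicants G by rewrite size_map size_enum_ord.
(* The unary sizes put [applicants G] and [posts G] below [N], which bounds the length and the words
   of the reply. *)
have [|||||m [R [[runE bound] readE]]] := @reduction_run O np w (encode_matching M).
- by rewrite -encode_single_rank.
- by rewrite -/N; lia.
- by rewrite size_M; lia.
- by apply: sub_all (encode_graph_bits G) => b; rewrite /geq /=; lia.
- by apply: sub_all (encode_matching_le M) => b; rewrite /geq /=; lia.
exists 17; split=> //; first by rewrite /polylog_bound leq_addl.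
exists M; split; first exact/popular_single_rank.
by rewrite runE.
Qed.
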